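(* Let $\mathfrak{R}$ be an elementary divisor domain that is not a field, with field of fractions $\mathbb{F}$. Let $A\in\mathfrak{R}^{n\times n}$, $B\in\mathfrak{R}^{n\times m}$, $C\in\mathfrak{R}^{p\times n}$ and $D\in\mathfrak{R}^{p\times m}$ with $\det A\neq 0$. Let $$P=\begin{bmatrix} A & B\\ C & D\end{bmatrix}\in\mathfrak{R}^{(n+p)\times (n+m)},\qquad G=D-CA^{-1}B\in\mathbb{F}^{p\times m},$$ and let $S_G \doteq \operatorname{Diag}\left(\frac{\varepsilon_1}{\psi_1},\ldots, \frac{\varepsilon_r}{\psi_r}\right) \oplus 0_{(p-r) \times (m-r)}$ be the Smith-McMillan form of $G$, where $g$ is the largest index in $\{1,\ldots ,r \}$ such that $\psi_g \notin \mathfrak{R}^\times$ (with $g=0$ if there is none). Consider the conditions (a) $A$ and $B$ are left coprime, (b) $A$ and $C$ are right coprime, and (i) the Smith form of $P$ is $S_P \doteq I_n \oplus \operatorname{Diag}(\varepsilon_1,\ldots, \varepsilon_r ) \oplus 0_{(p-r) \times (m-r)} \in \mathfrak{R}^{(n+p)\times (n+m)}$, (ii) the Smith form of $A$ is $S_A \doteq I_{n-g} \oplus \operatorname{Diag}( \psi_g,\ldots, \psi_1 ) \in \mathfrak{R}^{n\times n}$. Then (a) and (b) both hold if and only if (i) and (ii) both hold.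
   Context: An elementary divisor domain (EDD) is an integral domain $\mathfrak{R}$ such that every $a,b,c\in\mathfrak{R}$ have a greatest common divisor which can be written $\gcd(a,b,c)=zxa+zyb+wyc$ for some $x,y,z,w\in\mathfrak{R}$; equivalently, an integral domain over which every matrix has a Smith form (defined below). $\mathfrak{R}^\times$ is the group of units. A square matrix over $\mathfrak{R}$ is unimodular if it is invertible over $\mathfrak{R}$. Two matrices $M,N$ of the same size over $\mathbb{F}$ are equivalent if $UMV=N$ with $U,V$ unimodular over $\mathfrak{R}$. Rank is rank over $\mathbb{F}$. Smith form of $M\in\mathfrak{R}^{p\times m}$ of rank $r$: a matrix $\operatorname{Diag}(\alpha_1,\dots,\alpha_r)\oplus 0_{(p-r)\times(m-r)}$ equivalent to $M$ with all $\alpha_i\in\mathfrak R$ nonzero and $\alpha_1\mid\alpha_2\mid\cdots\mid\alpha_r$ (unique up to units). Smith-McMillan form of $G\in\mathbb{F}^{p\times m}$ of rank $r$: a matrix $\operatorname{Diag}(\varepsilon_1/\psi_1,\dots,\varepsilon_r/\psi_r)\oplus 0_{(p-r)\times(m-r)}$ equivalent to $G$, with nonzero $\varepsilon_i,\psi_i\in\mathfrak{R}$, $\varepsilon_1\mid\cdots\mid\varepsilon_r$, $\psi_r\mid\cdots\mid\psi_1$ and $\gcd(\varepsilon_i,\psi_i)\doteq 1$ (unique up to units). The symbol $\doteq$ means equality up to multiplication by a unit of $\mathfrak{R}$ (for scalars) or by a diagonal unimodular matrix (for matrices); ''the'' Smith(-McMillan) form is understood up to $\doteq$. $G_1\in\mathfrak{R}^{p\times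 m}$ and $G_2\in\mathfrak{R}^{q\times m}$ are right coprime if every $F\in\mathfrak{R}^{m\times m}$ with $G_1=\widetilde G_1F$, $G_2=\widetilde G_2F$ for some matrices $\widetilde G_1,\widetilde G_2$ over $\mathfrak{R}$ is unimodular. $H_1,H_2$ (same number of rows) are left coprime if $H_1^T,H_2^T$ are right coprime. $\oplus$ denotes the block diagonal sum; $0_{0\times q}$ (resp. $0_{p\times 0}$) in a direct sum means appending $q$ zero columns (resp. $p$ zero rows). *)

(* Defs.v *)
From mathcomp Require Import all_boot all_order all_algebra.

Set Implicit Arguments.
Unset Strict Implicit.
Unset Printing Implicit Defensive.

Import GRing.Theory.
Local Open Scope ring_scope.

Notation "x %:F" := (tofrac x) : ring_scope.
Notation "M ^%:F" := (map_mx (@tofrac _) M)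
  (at level 2, left associativity, format "M ^%:F") : ring_scope.

Definition divides (R : idomainType) (a b : R) : Prop := exists c, b = c * a.

Definition is_gcd (R : idomainType) (d : R) (s : seq R) : Prop :=
  (forall a, a \in s -> divides d a) /\
  (forall e, (forall a, a \in s -> divides e a) -> divides e d).

Definition elementary_divisor_domain (R : idomainType) : Prop :=
  forall a b c : R, exists x y z w : R,
    is_gcd (z * x * a + z * y * b + w * y * c) [:: a; b; c].

(* Diag(s) completed with zeros to size p x m. The entries of s beyond
   min(p, m) would be lost; below, s always has length the rank of a p x m
   matrix, so none are. *)
Definition diag_pad (K : nmodType) (p m : nat) (s : seq K) : 'M[K]_(p, m) :=
  \matrix_(i, j) (if i == j :> nat then s`_i else 0).

Definition equivalent (R : idomainType) (p m : nat)
    (M N : 'M[{fraction R}]_(p, m)) : Prop :=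
  exists (U : 'M[R]_p) (V : 'M[R]_m),
    [/\ U \in unitmx, V \in unitmx & U^%:F *m M *m V^%:F = N].

(* Smith forms are only defined up to units of R, so "the Smith form of M is
   S, up to units" reads "S is a Smith form of M". *)
Definition is_smith_form (R : idomainType) (p m : nat)
    (M : 'M[R]_(p, m)) (alpha : seq R) : Prop :=
  [/\ size alpha = \rank (M^%:F),
      forall a, a \in alpha -> a != 0,
      forall i, (i.+1 < size alpha)%N -> divides alpha`_i alpha`_i.+1
    & equivalent (M^%:F) ((diag_pad p m alpha)^%:F)].

Definition is_smith_mcmillan_form (R : idomainType) (p m : nat)
    (G : 'M[{fraction R}]_(p, m)) (eps psi : seq R) : Prop :=
  [/\ size eps = \rank G /\ size psi = \rank G,
      (forall e, e \in eps -> e != 0) /\ (forall f, f \in psi -> f != 0),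
      (forall i, (i.+1 < size eps)%N -> divides eps`_i eps`_i.+1) /\
      (forall i, (i.+1 < size psi)%N -> divides psi`_i.+1 psi`_i),
      forall i, (i < size eps)%N -> is_gcd 1 [:: eps`_i; psi`_i]
    & equivalent G
        (diag_pad p m [seq ef.1%:F / ef.2%:F | ef <- zip eps psi])].

(* 1-based: the largest k such that the k-th entry of s is not a unit, and 0
   if all entries are units. *)
Definition last_nonunit (R : idomainType) (s : seq R) : nat :=
  \max_(i < size s | s`_i \isn't a GRing.unit) i.+1.

Definition right_coprime (R : idomainType) (p q m : nat)
    (G1 : 'M[R]_(p, m)) (G2 : 'M[R]_(q, m)) : Prop :=
  forall F : 'M[R]_m,
    (exists (G1' : 'M[R]_(p, m)) (G2' : 'M[R]_(q, m)),
        G1 = G1' *m F /\ G2 = G2' *m F) ->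
    F \in unitmx.

Definition left_coprime (R : idomainType) (p m q : nat)
    (H1 : 'M[R]_(p, m)) (H2 : 'M[R]_(p, q)) : Prop :=
  right_coprime H1^T H2^T.

Definition transfer_function (R : idomainType) (n p m : nat)
    (A : 'M[R]_n) (B : 'M[R]_(n, m)) (C : 'M[R]_(p, n)) (D : 'M[R]_(p, m)) :
    'M[{fraction R}]_(p, m) :=
  D^%:F - C^%:F *m invmx (A^%:F) *m B^%:F.

(* Main.v *)
(* Over an elementary divisor domain every matrix has a Smith form, so left
   coprimeness of [A], [B] means that [A B] is the top block row of a unimodular
   [V].  Writing [N] and [W12] for the right blocks of [V^-1], one gets
   [diag(A, I) ~ diag(I, N)], and [P ~ diag(I, Y)] where [Y = C W12 + D N]
   satisfies [G N = Y]; right coprimeness of [A], [C] makes [Y N^-1] a right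
   coprime fraction of [G].  The Smith-McMillan form gives another one,
   [E Psi^-1], and two such fractions differ by a unimodular right factor.
   Hence [P ~ diag(I, E)] and [diag(A, I) ~ diag(I, Psi)], and uniqueness of
   Smith forms yields (i) and (ii).  Conversely, extracting common factors,
   [A = L A2 Q] where [A2] belongs to a coprime realization of the same [G];
   then, up to units, [det A2] is the product of the [psi_i], and so is [det A]
   by (ii), hence [L] and [Q] are unimodular. *)
Require Import Defs.
From mathcomp Require Import all_boot all_order all_algebra all_fingroup.
From mathcomp Require Import ring zify.

Import GRing.Theory.
Local Open Scope ring_scope.

Set Implicit Arguments.
Unset Strict Implicit.
Unset Printing Implicit Defensive.

(** * Divisibility in an integral domain *)

Section Divisibility.
Variable R : idomainType.
Implicit Types a b c d : R.

Lemma divides_refl a : divides a a.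
Proof. by exists 1; rewrite mul1r. Qed.

Lemma divides0 a : divides a 0.
Proof. by exists 0; rewrite mul0r. Qed.

Lemma divides_trans a b c : divides a b -> divides b c -> divides a c.
Proof. by move=> [x ->] [y ->]; exists (y * x); rewrite mulrA. Qed.

Lemma divides_mull a b c : divides a b -> divides a (c * b).
Proof. by move=> [x ->]; exists (c * x); rewrite mulrA. Qed.

Lemma divides_mulr a b c : divides a b -> divides a (b * c).
Proof. by rewrite mulrC; exact: divides_mull. Qed.

Lemma divides_mul2l c a b : divides a b -> divides (c * a) (c * b).
Proof. by move=> [x ->]; exists x; rewrite mulrCA. Qed.

Lemma divides_add a b c : divides a b -> divides a c -> divides a (b + c).
Proof. by move=> [x ->] [y ->]; exists (x + y); rewrite mulrDl. Qed.

Lemma divides_sum a (I : finType) (f : I -> R) :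
  (forall i, divides a (f i)) -> divides a (\sum_i f i).
Proof.
move=> af; elim/big_ind: _ => [|x y|i _] //; first exact: divides0.
exact: divides_add.
Qed.

Lemma unit_divides u a : u \is a GRing.unit -> divides u a.
Proof. by move=> uu; exists (a / u); rewrite divrK. Qed.

Lemma divides_antisym a b : divides a b -> divides b a ->
  exists2 u, u \is a GRing.unit & b = u * a.
Proof.
move=> [x b_xa] [y a_yb]; have [a0|a_neq0] := eqVneq a 0.
  by exists 1; rewrite ?unitr1 // b_xa a0 !mulr0.
exists x => //; apply/unitrPr; exists y.
by apply: (mulIf a_neq0); rewrite mul1r mulrAC -b_xa mulrC -a_yb.
Qed.

End Divisibility.

(** * Gcds of rows and matrices, and completion of rows, over an elementary divisor domain *)

Section ElementaryDivisor.
Variable R : idomainType.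
Hypothesis edd : elementary_divisor_domain R.

Lemma edd_gcd3 (a b c : R) : exists x y z w : R,
  let d := z * x * a + z * y * b + w * y * c in
  [/\ divides d a, divides d b & divides d c].
Proof.
have [x [y [z [w [dvd _]]]]] := edd a b c; exists x, y, z, w.
by split; apply: dvd; rewrite !inE eqxx ?orbT.
Qed.

Lemma edd_gcd2 (a b : R) : exists x y : R,
  divides (x * a + y * b) a /\ divides (x * a + y * b) b.
Proof.
have [x [y [z [w]]]] := edd_gcd3 a b 0; rewrite mulr0 addr0 => -[da db _].
by exists (z * x), (z * y).
Qed.

(** The combination given by [edd_gcd2] is a common divisor, hence divides 1, and can be
    rescaled. *)
Lemma coprime_bezout (a b : R) : is_gcd 1 [:: a; b] ->
  exists x y, x * a + y * b = 1.
Proof.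
move=> [_ gcd1]; have [x [y [da db]]] := edd_gcd2 a b.
have [|c c1] := gcd1 (x * a + y * b).
  by move=> e; rewrite !inE => /orP[] /eqP->.
by exists (c * x), (c * y); rewrite -!mulrA -mulrDr -c1.
Qed.

(** By induction, [edd_gcd2] combines the first entry with the gcd attained on the tail. *)
Lemma row_bezout m (r : 'rV[R]_m) :
  exists t : 'cV[R]_m, forall j, divides ((r *m t) 0 0) (r 0 j).
Proof.
elim: m => [|m IHm] in r *; first by exists 0 => -[].
rewrite -[m.+1]/(1 + m)%N in r *; have [t dvdt] := IHm (rsubmx r).
have [x [y [da db]]] := edd_gcd2 (r 0 0) ((rsubmx r *m t) 0 0).
exists (col_mx x%:M (y *: t)) => j.
rewrite -[r in r *m _]hsubmxK mul_row_col mul_mx_scalar -scalemxAr !mxE.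
rewrite [lshift _ _](_ : _ = 0); last exact: val_inj.
case: (splitP j) => [i ji|i ji].
  have -> : j = 0 by apply: val_inj; rewrite /= ji ord1.
  by rewrite !mxE in da *.
have -> : j = rshift 1 i by exact: val_inj.
have := dvdt i; rewrite !mxE in db *.
by apply: divides_trans.
Qed.

(* Elementary divisor property for the matrix [(b', a), (0, d')]: [d'] is the
   gcd of the lower rows, attained by [u', v'], [a] is the value of the first
   row at [v'], and [b'] is the gcd of the first row on the kernel of
   [u' *m M']. *)
Lemma matrix_gcd p m (M : 'M[R]_(p, m)) :
  exists (u : 'rV[R]_p) (v : 'cV[R]_m),
    forall i j, divides ((u *m M *m v) 0 0) (M i j).
Proof.
elim: p => [|p IHp] in M *; first by exists 0, 0 => -[].
rewrite -[p.+1]/(1 + p)%N in M *.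
set r := usubmx M; set M' := dsubmx M.
have [u' [v' dvd']] := IHp M'; set d' := (_ *m _) 0 0 in dvd'.
have [q qE] : exists q : 'rV[R]_m, u' *m M' = d' *: q.
  have /fin_all_exists [f fE] : forall j, exists c, (u' *m M') 0 j = c * d'.
    by move=> j; rewrite mxE; apply: divides_sum => k; apply: divides_mull.
  by exists (\row_j f j); apply/rowP => j; rewrite fE !mxE mulrC.
pose a := (r *m v') 0 0.
have aE : r *m v' = a%:M by rewrite [LHS]mx11_scalar.
have d'E : u' *m M' *m v' = d'%:M by rewrite [LHS]mx11_scalar.
(* Subtracting [v' *m q] sends every column into the kernel of [u' *m M'], even when [d' = 0]. *)
pose N := 1%:M - v' *m q.
have u'N : u' *m M' *m N = 0.
  by rewrite mulmxBr mulmx1 mulmxA d'E mul_scalar_mx qE subrr.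
have [t dvdt] := row_bezout (r *m N).
set b' := (_ *m t) 0 0 in dvdt.
have b'E : r *m N *m t = b'%:M by rewrite [LHS]mx11_scalar.
have [x [y [z [w]]]] := edd_gcd3 b' a d'; set d := _ + _ => /= -[db da dd].
(* The cross term in [w * x] vanishes because [u' *m M' *m N = 0]; the other three terms add up to
   [d]. *)
exists (row_mx z%:M (w *: u')), (x *: (N *m t) + y *: v').
set e := (_ *m _) 0 0.
have -> : e = d.
  rewrite /e -[M]vsubmxK -/r -/M' mul_row_col mul_scalar_mx -scalemxAl.
  rewrite mulmxDl !mulmxDr -!scalemxAl -!scalemxAr !mulmxA u'N b'E aE d'E.
  rewrite mul0mx !scaler0 add0r !mxE /= !mulr1n /d; ring.
move=> i j; case: (splitP i) => [k ik|k ik]; last first.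
  have -> : i = rshift 1 k by exact: val_inj.
  by have := dvd' k j; rewrite mxE; apply: divides_trans.
have -> : i = lshift p 0 by apply: val_inj; rewrite /= ik ord1.
(* [r = r *m N + a *: q], and [d] divides both [a] and, through [b'], the row [r *m N]. *)
have -> : M (lshift p 0) j = (r *m N) 0 j + a * q 0 j.
  rewrite mulmxBr mulmx1 mulmxA aE mul_scalar_mx !mxE; ring.
by apply: divides_add; [apply: divides_trans (dvdt j) | apply: divides_mulr].
Qed.

(** The tail is reduced first; a 2 x 2 unimodular matrix of Bezout coefficients then merges its [h]
    with the leading entry. *)
Lemma row_hermite k (b : 'rV[R]_(1 + k)) :
  exists (V : 'M[R]_(1 + k)) (h : R), V \in unitmx /\ b *m V = row_mx h%:M 0.
Proof.
elim: k => [|k IHk] in b *.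
  exists 1%:M, (b 0 0); rewrite unitmx1 mulmx1; split=> //.
  apply/rowP => j; rewrite (ord1 j) !mxE; case: splitP => // i.
  by rewrite (ord1 i) mxE mulr1n.
have [V' [h [V'u bV']]] := IHk (rsubmx b).
pose b0 := b 0 0; have [x [y]] := edd_gcd2 b0 h.
set g := _ + _ => -[[be b0E] [eta hE]].
have [V2 V2u V2E] : exists2 V2 : 'M[R]_(1 + 1),
    V2 \in unitmx & row_mx b0%:M h%:M *m V2 = row_mx g%:M 0.
  (* If [g = 0], both entries already vanish; otherwise cancelling [g] in [g = x * b0 + y * h]
     yields [x * be + y * eta = 1]. *)
  have [g0|g_neq0] := eqVneq g 0.
    exists 1%:M; first exact: unitmx1.
    by rewrite mulmx1 b0E hE g0 !mulr0 (_ : 0%:M = 0) // raddf0.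
  exists (block_mx x%:M (- eta)%:M y%:M be%:M).
    have bezout : x * be + y * eta = 1.
      by apply: (mulIf g_neq0); rewrite mul1r {2}/g b0E hE; ring.
    pose W : 'M[R]_(1 + 1) := block_mx be%:M eta%:M (- y)%:M x%:M.
    suff /mulmx1_unit[] : block_mx x%:M (- eta)%:M y%:M be%:M *m W = 1%:M by [].
    rewrite mulmx_block -!scalar_mxM -!raddfD (scalar_mx_block 1 1).
    congr block_mx;
      [congr _%:M|rewrite -[RHS](raddf0 (@scalar_mx R 1))..|congr _%:M].
    - by rewrite -bezout; ring.
    - by congr _%:M; ring.
    - by congr _%:M; ring.
    - by rewrite -bezout; ring.
  rewrite mul_row_block -!scalar_mxM -!raddfD; congr row_mx.
    by congr _%:M; rewrite /g; ring.
  rewrite -[RHS](raddf0 (@scalar_mx R 1)); congr _%:M.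
  by rewrite [in LHS]b0E [in LHS]hE; ring.
(* [V1] acts on the tail and [V3] on the first two entries, whence the two groupings of the
   index. *)
pose V1 : 'M[R]_(1 + (1 + k)) := block_mx 1%:M 0 0 V'.
pose V3 : 'M[R]_((1 + 1) + k) := block_mx V2 0 0 1%:M.
have V1u : V1 \in unitmx by rewrite block_diag_mx_unit unitmx1.
have V3u : V3 \in unitmx by rewrite block_diag_mx_unit unitmx1 V2u.
exists (V1 *m V3), g; split; first by rewrite unitmx_mul V1u.
have bV1 : b *m V1 = row_mx (lsubmx b) (row_mx h%:M 0).
  rewrite -[b in LHS]hsubmxK mul_row_block.
  by rewrite !mulmx0 mulmx1 addr0 add0r bV'.
rewrite mulmxA {}bV1.
have -> : row_mx (lsubmx b) (row_mx h%:M 0) =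
    row_mx (row_mx b0%:M h%:M) 0 :> 'rV[R]_((1 + 1) + k).
  have -> : lsubmx b = b0%:M.
    by rewrite [LHS]mx11_scalar mxE; congr (b _ _)%:M; exact: val_inj.
  apply/rowP => j; rewrite row_mxA castmxE /= cast_ord_id.
  by congr (_ _ _); exact: val_inj.
have V3E : row_mx (row_mx b0%:M h%:M) 0 *m V3 = row_mx (row_mx g%:M 0) 0.
  by rewrite mul_row_block !mulmx0 mul0mx !addr0 V2E.
apply: etrans V3E _.
transitivity (row_mx g%:M (row_mx 0 0) : 'rV[R]_(1 + (1 + k))); last first.
  by rewrite row_mx0.
apply/rowP => j; rewrite row_mxA castmxE /= cast_ord_id.
by congr (_ _ _); exact: val_inj.
Qed.

(** In the reduced row [(h, 0)] of [b], the identity [b *m w = 1] forces [h] to be a unit, so [b] is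
    the first row of [diag(h, I) V^-1]. *)
Lemma complete_row k (b : 'rV[R]_(1 + k)) (w : 'cV[R]_(1 + k)) :
  b *m w = 1%:M -> exists2 U : 'M[R]_(1 + k), U \in unitmx & usubmx U = b.
Proof.
move=> bw1; have [V [h [Vu bV]]] := row_hermite b.
have hu : h \is a GRing.unit.
  have : b *m V *m (invmx V *m w) = 1%:M by rewrite mulmxA mulmxK.
  rewrite bV -[_ *m w]vsubmxK mul_row_col mul0mx addr0 mul_scalar_mx.
  move/matrixP/(_ 0 0); rewrite !mxE => h1; apply/unitrPr.
  by eexists; exact: h1.
exists (block_mx h%:M 0 0 1%:M *m invmx V).
  rewrite unitmx_mul unitmx_inv Vu block_diag_mx_unit unitmx1.
  by rewrite unitmxE det_scalar1 hu.
rewrite /block_mx mul_col_mx col_mxKu.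
by rewrite -bV mulmxK.
Qed.

End ElementaryDivisor.

(** * Unimodular equivalence and Smith forms *)

Section Equivalence.
Variable R : comUnitRingType.

(** Equivalence without passing to fractions; [equivalent_tofrac] relates it to [equivalent]. *)
Definition mx_equiv p m (M N : 'M[R]_(p, m)) : Prop :=
  exists (U : 'M[R]_p) (V : 'M[R]_m),
    [/\ U \in unitmx, V \in unitmx & U *m M *m V = N].

Lemma mx_equiv_refl p m (M : 'M[R]_(p, m)) : mx_equiv M M.
Proof. by exists 1%:M, 1%:M; rewrite !unitmx1 mul1mx mulmx1. Qed.

Lemma mx_equiv_sym p m (M N : 'M[R]_(p, m)) : mx_equiv M N -> mx_equiv N M.
Proof.
move=> [U [V [Uu Vu <-]]]; exists (invmx U), (invmx V).
by rewrite !unitmx_inv !mulmxA mulmxK // mulVmx // mul1mx.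
Qed.

Lemma mx_equiv_trans p m (M N Q : 'M[R]_(p, m)) :
  mx_equiv M N -> mx_equiv N Q -> mx_equiv M Q.
Proof.
move=> [U [V [Uu Vu <-]]] [U' [V' [U'u V'u <-]]].
exists (U' *m U), (V *m V'); split; first by rewrite unitmx_mul U'u.
  by rewrite unitmx_mul Vu.
by rewrite !mulmxA.
Qed.

Lemma mx_equivMl p m (U : 'M[R]_p) (M : 'M[R]_(p, m)) :
  U \in unitmx -> mx_equiv (U *m M) M.
Proof.
move=> Uu; apply: mx_equiv_sym; exists U, 1%:M.
by rewrite Uu unitmx1 mulmx1.
Qed.

Lemma mx_equivMr p m (M : 'M[R]_(p, m)) (V : 'M[R]_m) :
  V \in unitmx -> mx_equiv (M *m V) M.
Proof.
move=> Vu; apply: mx_equiv_sym; exists 1%:M, V.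
by rewrite Vu unitmx1 mul1mx.
Qed.

Lemma mx_equiv_dsum p m q l (M N : 'M[R]_(p, m)) (M' N' : 'M[R]_(q, l)) :
  mx_equiv M N -> mx_equiv M' N' ->
  mx_equiv (block_mx M 0 0 M') (block_mx N 0 0 N').
Proof.
move=> [U [V [Uu Vu <-]]] [U' [V' [U'u V'u <-]]].
exists (block_mx U 0 0 U'), (block_mx V 0 0 V').
rewrite !block_diag_mx_unit Uu Vu U'u V'u; split=> //.
by rewrite !mulmx_block !(mul0mx, mulmx0, addr0, add0r).
Qed.

Lemma mx_equiv_scale p m (a : R) (M N : 'M[R]_(p, m)) :
  mx_equiv M N -> mx_equiv (a *: M) (a *: N).
Proof.
by move=> [U [V [Uu Vu <-]]]; exists U, V; rewrite -scalemxAr -scalemxAl.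
Qed.

Lemma mx_equiv_det n (M N : 'M[R]_n) :
  mx_equiv M N -> exists2 u, u \is a GRing.unit & \det N = u * \det M.
Proof.
move=> [U [V [Uu Vu <-]]]; exists (\det U * \det V).
  by rewrite unitrM -!unitmxE Uu.
by rewrite !det_mulmx mulrAC.
Qed.

Lemma lblock_unitmx p q (X : 'M[R]_(q, p)) :
  block_mx 1%:M 0 X 1%:M \in unitmx.
Proof. by rewrite unitmxE det_lblock !det1 mulr1 unitr1. Qed.

Lemma ublock_unitmx p q (X : 'M[R]_(p, q)) :
  block_mx 1%:M X 0 1%:M \in unitmx.
Proof. by rewrite unitmxE det_ublock !det1 mulr1 unitr1. Qed.

End Equivalence.

(** * Rectangular diagonal matrices *)

Section DiagPad.
Variable R : comUnitRingType.
Implicit Types s t : seq R.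

(** Only diagonal indices below the inner dimension [m] survive the product, whence the two
    hypotheses. *)
Lemma mul_diag_pad p m q s t (u : seq R) :
  (forall i, (i < m)%N -> u`_i = s`_i * t`_i) ->
  (forall i, (m <= i)%N -> u`_i = 0) ->
  diag_pad p m s *m diag_pad m q t = diag_pad p q u.
Proof.
move=> u_lt u_ge; apply/matrixP => i j; rewrite !mxE.
have [im|mi] := ltnP i m; last first.
  rewrite u_ge // if_same big1 // => k _; rewrite mxE.
  by rewrite gtn_eqF ?mul0r // (leq_trans (ltn_ord k)).
rewrite (bigD1 (Ordinal im)) //= big1 => [|k].
  by rewrite addr0 !mxE /= eqxx u_lt //; case: ifP; rewrite ?mulr0.
move=> /negP k_neq; rewrite mxE ifF ?mul0r //; apply/negP => /eqP ik.
by apply: k_neq; apply/eqP/val_inj.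
Qed.

Lemma diag_pad_cat n p m s t : size s = n ->
  diag_pad (n + p) (n + m) (s ++ t) =
  block_mx (diag_pad n n s) 0 0 (diag_pad p m t).
Proof.
move=> sn; apply/matrixP => i j; rewrite [LHS]mxE nth_cat sn.
case: (splitP i) => i' ii'; [have -> : i = lshift p i' by exact: val_inj |
  have -> : i = rshift n i' by exact: val_inj];
case: (splitP j) => j' jj'; [have -> : j = lshift m j' by exact: val_inj |
  have -> : j = rshift n j' by exact: val_inj |
  have -> : j = lshift m j' by exact: val_inj |
  have -> : j = rshift n j' by exact: val_inj ];
rewrite ?(block_mxEul, block_mxEur, block_mxEdl, block_mxEdr) !mxE /=.
- by [].
- by rewrite ltn_eqF // ltn_addr.
- by rewrite gtn_eqF // ltn_addr.
- by rewrite eqn_add2l addKn.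
Qed.

Lemma diag_pad1 n : diag_pad n n (nseq n 1) = 1%:M :> 'M[R]_n.
Proof.
by apply/matrixP => i j; rewrite !mxE nth_nseq ltn_ord -val_eqE; case: eqP.
Qed.

Lemma det_diag_pad n s : size s = n -> \det (diag_pad n n s) = \prod_(a <- s) a.
Proof.
move=> sn; rewrite det_trig; last first.
  by apply/is_trig_mxP => i j ij; rewrite mxE ltn_eqF.
rewrite (big_nth 0) sn big_mkord; apply: eq_bigr => i _.
by rewrite mxE eqxx.
Qed.

Lemma diag_pad_perm n s t : size s = n -> perm_eq s t ->
  mx_equiv (diag_pad n n s) (diag_pad n n t).
Proof.
move=> sn st; have tn : size t == n by rewrite -(perm_size st) sn.
have /tuple_permP [w sE] : perm_eq s (Tuple tn) by [].
apply: mx_equiv_sym; exists (perm_mx w), (perm_mx w^-1).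
rewrite !unitmx_perm -row_permE -col_permE; split=> //.
apply/matrixP => i j; rewrite !mxE sE (inj_eq val_inj) (inj_eq perm_inj).
rewrite -(inj_eq val_inj); case: eqP => // _.
rewrite (nth_map i) ?size_enum_ord // (tnth_nth 0) /=.
by congr (_`_(w _)); apply: val_inj; rewrite /= nth_enum_ord.
Qed.

Lemma diag_pad_assoc n s t :
  (forall i, (i < n)%N -> exists2 u, u \is a GRing.unit & t`_i = u * s`_i) ->
  mx_equiv (diag_pad n n s) (diag_pad n n t).
Proof.
move=> st; have /fin_all_exists2 [f fu fE] : forall i : 'I_n,
    exists2 u, u \is a GRing.unit & t`_i = u * s`_i by move=> i; apply: st.
exists (diag_mx (\row_i f i)), 1%:M; rewrite unitmx1 mulmx1; split=> //.
  by rewrite unitmxE det_diag; apply: rpred_prod => i _; rewrite mxE.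
apply/matrixP => i j; rewrite mul_diag_mx !mxE.
by case: eqP => _; rewrite ?mulr0 ?fE.
Qed.

End DiagPad.

(** * Uniqueness and existence of Smith forms *)

Section Smith.
Variable R : idomainType.
Implicit Types a b : seq R.

(** No bound on [i] is imposed: past the end the default entry is 0, which everything divides. *)
Definition div_chain a := forall i, divides a`_i a`_i.+1.

Lemma div_chain_leq a i j : div_chain a -> (i <= j)%N -> divides a`_i a`_j.
Proof.
move=> ch /subnKC <-; elim: (j - i)%N => [|k IHk].
  by rewrite addn0; exact: divides_refl.
by rewrite addnS; apply: divides_trans IHk (ch _).
Qed.

Lemma div_chain_ones k (s : seq R) : div_chain s -> div_chain (nseq k 1 ++ s).
Proof.
move=> chs i; rewrite !nth_cat size_nseq.
have [ik|ki] := ltnP i k.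
  by rewrite nth_nseq ik; apply: unit_divides; exact: unitr1.
by rewrite ltnNge (leqW ki) subSn.
Qed.

Lemma div_chain_sub (s : seq R) :
  (forall i, (i.+1 < size s)%N -> divides s`_i s`_i.+1) -> div_chain s.
Proof.
move=> chs i; have [|si] := ltnP i.+1 (size s); first exact: chs.
by rewrite [s`_i.+1]nth_default //; exact: divides0.
Qed.

Lemma div_chain_rev (s : seq R) :
  (forall i, (i.+1 < size s)%N -> divides s`_i.+1 s`_i) -> div_chain (rev s).
Proof.
move=> chs; apply: div_chain_sub => i; rewrite size_rev => si.
rewrite !nth_rev ?(ltnW si) // -[in X in divides X _](subnSK si).
by apply: chs; rewrite subnSK // ltn_subrL; apply: leq_trans si.
Qed.

(* Every term of the expansion of [\det V] has a factor in the top right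
   [(k+1) x (m-k)] corner, because [(k+1) + (m-k) > m]. *)
Lemma smith_divides p m (U : 'M[R]_p) (V : 'M[R]_m) a b k :
  V \in unitmx -> div_chain a -> div_chain b -> (k < p)%N -> (k < m)%N ->
  U *m diag_pad p m a = diag_pad p m b *m V -> divides a`_k b`_k.
Proof.
move=> Vu cha chb kp km UV.
(* [b_k V_ij] is a multiple of [b_i V_ij], which is entry [(i, j)] of [U Diag(a)], a multiple of
   [a_j] and so of [a_k]. *)
have corner (i j : 'I_m) : (i <= k <= j)%N -> divides a`_k (b`_k * V i j).
  move=> /andP[ik kj]; have ip := leq_ltn_trans ik kp.
  have [c ->] := div_chain_leq chb ik; rewrite -mulrA; apply: divides_mull.
  have -> : b`_i * V i j = (diag_pad p m b *m V) (Ordinal ip) j.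
    rewrite mxE (bigD1 i) //= big1 ?addr0 ?mxE ?eqxx // => l /negP li.
    by rewrite mxE ifF ?mul0r //; apply/negP => /eqP il; apply/li/eqP/val_inj.
  rewrite -UV mxE; apply: divides_sum => l; apply: divides_mull; rewrite mxE.
  by case: eqP => [->|_]; [exact: div_chain_leq | exact: divides0].
suff: divides a`_k (b`_k * \det V).
  move: Vu; rewrite unitmxE => Vu /(divides_mulr (\det V)^-1).
  by rewrite mulrK.
rewrite big_distrr /=; apply: divides_sum => s.
have [i ik ksi] : exists2 i : 'I_m, (i <= k)%N & (k <= s i)%N.
  (* Pigeonhole: [s] cannot map the [k + 1] indices up to [k] into the [k] indices below [k]. *)
  pose lo := [set i : 'I_m | (i < k)%N]; pose le := [set i : 'I_m | (i <= k)%N].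
  have : ~~ (s @: le \subset lo).
    apply/negP => /subset_leq_card; rewrite card_imset; last exact: perm_inj.
    have -> : le = Ordinal km |: lo.
      by apply/setP => i; rewrite !inE leq_eqVlt -val_eqE.
    by rewrite cardsU1 inE ltnn add1n ltnn.
  move=> /subsetPn [x /imsetP[i ik ->] sik]; exists i.
    by rewrite inE in ik.
  by rewrite inE -leqNgt in sik.
rewrite mulrCA (bigD1 i) //= mulrA mulrA; apply: divides_mulr.
by rewrite -mulrA; apply: divides_mull; apply: corner; rewrite ik.
Qed.

Lemma smith_unique p m a b k : div_chain a -> div_chain b ->
  (k < p)%N -> (k < m)%N -> mx_equiv (diag_pad p m a) (diag_pad p m b) ->
  exists2 u, u \is a GRing.unit & b`_k = u * a`_k.
Proof.
move=> cha chb kp km.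
have dvd s t : div_chain s -> div_chain t ->
    mx_equiv (diag_pad p m s) (diag_pad p m t) -> divides s`_k t`_k.
  move=> chs cht [U [V [_ Vu UV]]].
  apply: (@smith_divides p m U (invmx V)); rewrite ?unitmx_inv //.
  by rewrite -UV mulmxK.
by move=> ab; apply: divides_antisym; apply: dvd => //; apply: mx_equiv_sym.
Qed.

Hypothesis edd : elementary_divisor_domain R.

(** Write [M = d *: M1] with [d = u M v] the gcd of the entries, so that [u M1 v = 1]. Completing
    [u] and [v] to unimodular matrices puts 1 in the corner of [M1], which clears its row and
    column. *)
Lemma gcd_split p m (M : 'M[R]_(1 + p, 1 + m)) :
  exists (d : R) (N : 'M[R]_(p, m)),
    mx_equiv M (block_mx d%:M 0 0 (d *: N)).
Proof.
have [-> |M_neq0] := eqVneq M 0.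
  by exists 0, 0; rewrite scaler0 raddf0 block_mx_const; exact: mx_equiv_refl.
have [u [v dvd]] := matrix_gcd edd M; set d := (_ *m _) 0 0 in dvd.
have d_neq0 : d != 0.
  apply: contraNneq M_neq0 => d0; apply/eqP/matrixP => i j; rewrite mxE.
  by have [c ->] := dvd i j; rewrite d0 mulr0.
have [M1 ME] : exists M1, M = d *: M1.
  have /fin_all_exists [f fE] : forall ij, exists c, M ij.1 ij.2 = c * d.
    by move=> ij; apply: dvd.
  exists (\matrix_(i, j) f (i, j)); apply/matrixP => i j.
  by rewrite (fE (i, j)) !mxE mulrC.
have uM1v : u *m M1 *m v = 1%:M.
  rewrite [LHS]mx11_scalar; congr _%:M; apply: (mulfI d_neq0).
  transitivity ((u *m M *m v) 0 0); last by rewrite mulr1.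
  by rewrite ME -scalemxAr -scalemxAl [RHS]mxE.
have [U Uu uE] := complete_row edd (etrans (mulmxA _ _ _) uM1v).
have [V Vu vE] : exists2 V : 'M[R]_(1 + m), V \in unitmx & lsubmx V = v.
  have vM1u : v^T *m (u *m M1)^T = 1%:M by rewrite -trmx_mul uM1v trmx1.
  have [W Wu wE] := complete_row edd vM1u.
  by exists W^T; rewrite ?unitmx_tr // -[v]trmxK -wE trmx_usub.
pose Q := U *m M1 *m V.
have Q1 : ulsubmx Q = 1%:M.
  rewrite -uM1v -uE -vE /ulsubmx /Q -[in LHS](vsubmxK U).
  by rewrite !mul_col_mx col_mxKu -[in LHS](hsubmxK V) mul_mx_row row_mxKl.
set b := ursubmx Q; set c := dlsubmx Q; set N := drsubmx Q.
have QE : Q = block_mx 1%:M b c N by rewrite -Q1 submxK.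
(* The Schur complement of the corner entry 1. *)
exists d, (N - c *m b).
have -> : block_mx d%:M 0 0 (d *: (N - c *m b)) =
    d *: block_mx (1%:M : 'M_1) 0 0 (N - c *m b).
  by rewrite scale_block_mx scalemx1 !scaler0.
rewrite ME; apply: mx_equiv_scale; apply: (@mx_equiv_trans _ _ _ _ Q).
  by exists U, V.
exists (block_mx 1%:M 0 (- c) 1%:M), (block_mx 1%:M (- b) 0 1%:M).
rewrite lblock_unitmx ublock_unitmx QE; split=> //.
rewrite !mulmx_block !(mulmx1, mul1mx, mulmx0, mul0mx, addr0, add0r).
by rewrite !addNr mul0mx add0r mulNmx addrC.
Qed.

(** Recursion on the block [N] of [gcd_split]: scaling its Smith form by [d] makes [d] divide all
    later entries. Trailing zeros are kept, so the length is [minn p m], not the rank. *)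
Lemma smith_exists p m (M : 'M[R]_(p, m)) : exists a : seq R,
  [/\ size a = minn p m, div_chain a & mx_equiv M (diag_pad p m a)].
Proof.
elim: p m => [|p IHp] [|m] in M *.
1-3: by exists [::]; rewrite ?minn0 ?min0n; split=> // [i|];
  rewrite ?nth_nil; [exact: divides0
  | rewrite ?[M]flatmx0 ?[M]thinmx0 ?[diag_pad _ _ _]flatmx0
      ?[diag_pad _ _ _]thinmx0; exact: mx_equiv_refl].
have [d [N MN]] := @gcd_split p m M.
have [a [sa cha Na]] := IHp _ N.
exists (d :: [seq d * x | x <- a]); split.
- by rewrite /= size_map sa minnSS.
- have nthE i : [seq d * x | x <- a]`_i = d * a`_i.
    have [ia|ai] := ltnP i (size a); first by rewrite (nth_map 0).
    by rewrite !nth_default ?size_map // mulr0.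
  case=> [|i] /=; rewrite !nthE; first by exists (a`_0); rewrite mulrC.
  exact: divides_mul2l.
apply: (mx_equiv_trans MN); rewrite -cat1s.
rewrite -[diag_pad _ _ _]/(diag_pad (1 + p) (1 + m) _) diag_pad_cat //.
apply: mx_equiv_dsum.
  suff -> : diag_pad 1 1 [:: d] = d%:M by exact: mx_equiv_refl.
  by apply/matrixP => i j; rewrite !ord1 !mxE.
suff -> : diag_pad p m [seq d * x | x <- a] = d *: diag_pad p m a.
  exact: mx_equiv_scale.
apply/matrixP => i j; rewrite !mxE; case: eqP => _; last by rewrite mulr0.
have [ia|ai] := ltnP i (size a); first by rewrite (nth_map 0).
by rewrite !nth_default ?size_map // mulr0.
Qed.

End Smith.

(** * Coprime matrices and coprime realizations *)

Section Coprime.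
Variable R : idomainType.

Lemma bezout_right_coprime n p m (A : 'M[R]_(n, m)) (C : 'M[R]_(p, m)) X Y :
  X *m A + Y *m C = 1%:M -> right_coprime A C.
Proof.
move=> XAYC F [A' [C' [AE CE]]].
have : (X *m A' + Y *m C') *m F = 1%:M by rewrite mulmxDl -!mulmxA -AE -CE.
by case/mulmx1_unit.
Qed.

Lemma bezout_left_coprime n m q (A : 'M[R]_(n, m)) (B : 'M[R]_(n, q)) X Y :
  A *m X + B *m Y = 1%:M -> left_coprime A B.
Proof.
move=> AXBY; apply: (@bezout_right_coprime _ _ _ _ _ X^T Y^T).
by rewrite -!trmx_mul -raddfD /= AXBY trmx1.
Qed.

Hypothesis edd : elementary_divisor_domain R.

(** The Smith form of [[A B]] is [[S 0]], so only the top rows of the right unimodular factor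
    matter, and [U^-1 S] is a common left factor. *)
Lemma left_factor n m (A : 'M[R]_n) (B : 'M[R]_(n, m)) :
  exists (L : 'M[R]_n) (V : 'M[R]_(n + m)),
    V \in unitmx /\ row_mx A B = L *m usubmx V.
Proof.
have [a [_ _ [U [W [Uu Wu UW]]]]] := smith_exists edd (row_mx A B).
have aE : diag_pad n (n + m) a = row_mx (diag_pad n n a) 0.
  apply/matrixP => i j; rewrite !mxE; case: splitP => k ->; rewrite mxE //.
  by rewrite ltn_eqF // ltn_addr.
exists (invmx U *m diag_pad n n a), (invmx W); rewrite unitmx_inv; split=> //.
have UV : row_mx A B = invmx U *m (row_mx (diag_pad n n a) 0 *m invmx W).
  by rewrite -aE -UW !mulmxA mulVmx // mul1mx mulmxK.
rewrite UV -[in LHS](vsubmxK (invmx W)) mul_row_col mul0mx addr0.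
by rewrite mulmxA.
Qed.

Lemma usubmx_unit_bezout n m (V : 'M[R]_(n + m)) : V \in unitmx ->
  usubmx V *m lsubmx (invmx V) = 1%:M.
Proof.
move=> Vu; rewrite mulmx_lsub mul_usub_mx mulmxV //.
by rewrite (scalar_mx_block n m) -/(ulsubmx _) block_mxKul.
Qed.

(** By coprimeness the common factor [L] is unimodular, so it can be absorbed into [V]. *)
Lemma left_coprime_complete n m (A : 'M[R]_n) (B : 'M[R]_(n, m)) :
  left_coprime A B ->
  exists2 V : 'M[R]_(n + m), V \in unitmx & usubmx V = row_mx A B.
Proof.
move=> copAB; have [L [V [Vu ABE]]] := left_factor A B.
have Lu : L \in unitmx.
  rewrite -unitmx_tr; apply: copAB.
  exists (lsubmx (usubmx V))^T, (rsubmx (usubmx V))^T.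
  rewrite -!trmx_mul !mulmx_lsub !mulmx_rsub -ABE.
  by rewrite row_mxKl row_mxKr.
exists (block_mx L 0 0 1%:M *m V).
  by rewrite unitmx_mul block_diag_mx_unit Lu unitmx1.
rewrite -mul_usub_mx /block_mx col_mxKu -[in LHS](vsubmxK V) mul_row_col.
by rewrite mul0mx addr0 ABE.
Qed.

Lemma left_coprime_bezout n m (A : 'M[R]_n) (B : 'M[R]_(n, m)) :
  left_coprime A B -> exists X Y, A *m X + B *m Y = 1%:M.
Proof.
move=> /left_coprime_complete [V Vu VE].
have := usubmx_unit_bezout Vu; rewrite VE -(vsubmxK (lsubmx _)) mul_row_col.
by move=> VX; eexists; eexists; exact: VX.
Qed.

(** The quotients by the factor of [left_factor] are top rows of a unimodular matrix, hence satisfy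
    a Bezout identity. *)
Lemma left_coprime_factor n m (A : 'M[R]_n) (B : 'M[R]_(n, m)) :
  exists (L A' : 'M[R]_n) (B' : 'M[R]_(n, m)),
    [/\ A = L *m A', B = L *m B' & left_coprime A' B'].
Proof.
have [L [V [Vu ABE]]] := left_factor A B.
exists L, (lsubmx (usubmx V)), (rsubmx (usubmx V)).
rewrite mulmx_lsub mulmx_rsub -ABE row_mxKl row_mxKr; split=> //.
have := usubmx_unit_bezout Vu.
rewrite -{1}(hsubmxK (usubmx V)) -(vsubmxK (lsubmx _)) mul_row_col.
exact: bezout_left_coprime.
Qed.

Lemma right_coprime_bezout n p (A : 'M[R]_n) (C : 'M[R]_(p, n)) :
  right_coprime A C -> exists X Y, X *m A + Y *m C = 1%:M.
Proof.
rewrite -[A]trmxK -[C]trmxK => /left_coprime_bezout [X [Y XY]].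
by exists X^T, Y^T; rewrite -!trmx_mul -raddfD /= XY trmx1.
Qed.

Lemma right_coprime_factor n p (A : 'M[R]_n) (C : 'M[R]_(p, n)) :
  exists (L A' : 'M[R]_n) (C' : 'M[R]_(p, n)),
    [/\ A = A' *m L, C = C' *m L & right_coprime A' C'].
Proof.
have [L [A' [C' [AE CE copAC]]]] := left_coprime_factor A^T C^T.
exists L^T, A'^T, C'^T; split=> //; apply: trmx_inj.
  by rewrite trmx_mul !trmxK.
by rewrite trmx_mul !trmxK.
Qed.

End Coprime.

(** * Matrices over the fraction field and their ranks *)

Section Fraction.
Variable R : idomainType.
Local Notation F := {fraction R}.

Lemma tofrac_mx_inj p m : injective (fun M : 'M[R]_(p, m) => M^%:F).
Proof.
move=> M N /matrixP MN; apply/matrixP => i j; have := MN i j.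
by rewrite !mxE => /eqP; rewrite tofrac_eq => /eqP.
Qed.

Lemma equivalent_tofrac p m (M N : 'M[R]_(p, m)) :
  equivalent M^%:F N^%:F <-> mx_equiv M N.
Proof.
split=> -[U [V [Uu Vu UV]]]; exists U, V; split=> //.
  by apply: tofrac_mx_inj; rewrite !map_mxM.
by rewrite -!map_mxM UV.
Qed.

Lemma tofrac_unitmx n (M : 'M[R]_n) : (M^%:F \in unitmx) = (\det M != 0).
Proof. by rewrite unitmxE det_map_mx unitfE tofrac_eq0. Qed.

Lemma unitmx_tofrac n (M : 'M[R]_n) : M \in unitmx -> M^%:F \in unitmx.
Proof.
move=> Mu; rewrite tofrac_unitmx; apply: contraTneq Mu => M0.
by rewrite unitmxE M0 unitr0.
Qed.

Lemma map_diag_pad p m (s : seq R) :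
  (diag_pad p m s)^%:F = diag_pad p m (map (@tofrac R) s).
Proof.
apply/matrixP => i j; rewrite !mxE; case: eqP => _; last exact: tofrac0.
have [si|si] := ltnP i (size s); first by rewrite (nth_map 0).
by rewrite !nth_default ?size_map // tofrac0.
Qed.

Lemma mxrank_diag_pad (K : fieldType) p m (s : seq K) :
  (forall a, a \in s -> a != 0) -> (size s <= p)%N -> (size s <= m)%N ->
  \rank (diag_pad p m s) = size s.
Proof.
(* Padding [s] with ones gives an invertible left factor; the remaining factor is a partial identity
   of rank [size s]. *)
move=> s_neq0 sp sm; set t := s ++ nseq (p - size s) 1.
have st : size t = p by rewrite size_cat size_nseq subnKC.
have -> : diag_pad p m s = diag_pad p p t *m diag_pad p m (nseq (size s) 1).
  rewrite (@mul_diag_pad _ _ _ _ _ _ s) // => i pi.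
    rewrite nth_cat; case: ltnP => si; first by rewrite nth_nseq si mulr1.
    rewrite [LHS]nth_default // [(nseq (size s) 1)`_i]nth_nseq.
    by rewrite ltnNge si mulr0.
  by rewrite nth_default // (leq_trans sp).
have tu : diag_pad p p t \in unitmx.
  rewrite unitmxE det_diag_pad // unitfE prodf_seq_neq0 all_cat.
  apply/andP; split; first by apply/allP => a; exact: s_neq0.
  by apply/allP => a /nseqP[-> _]; exact: oner_neq0.
rewrite (eqmxMfull _ (introT row_fullP _)); last first.
  by exists (invmx (diag_pad p p t)); rewrite mulVmx.
rewrite -[RHS](@rank_pid_mx K p m) //; congr (\rank _).
apply/matrixP => i j; rewrite !mxE nth_nseq.
by case: eqP; case: ltnP.
Qed.

Lemma mxrank_equivalent p m (M N : 'M[F]_(p, m)) :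
  equivalent M N -> \rank M = \rank N.
Proof.
move=> [U [V [Uu Vu <-]]]; rewrite mxrankMfree ?row_free_unit ?unitmx_tofrac //.
by rewrite eqmxMfull // row_full_unit unitmx_tofrac.
Qed.

Lemma mx_equiv_smith_form p m (M : 'M[R]_(p, m)) (s : seq R) :
  (forall a, a \in s -> a != 0) -> (size s <= p)%N -> (size s <= m)%N ->
  div_chain s -> mx_equiv M (diag_pad p m s) -> is_smith_form M s.
Proof.
move=> s_neq0 sp sm chs /equivalent_tofrac Ms; split=> //.
rewrite (mxrank_equivalent Ms) map_diag_pad mxrank_diag_pad ?size_map //.
by move=> a /mapP[b bs ->]; rewrite tofrac_eq0 s_neq0.
Qed.

End Fraction.

(** * Coprime right fractions obtained from coprime realizations *)

Section Realization.
Variable R : idomainType.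
Local Notation F := {fraction R}.
Hypothesis edd : elementary_divisor_domain R.

Lemma mx_equiv_lblock p q m (U : 'M[R]_p) (X : 'M[R]_(q, p))
    (Y : 'M[R]_(q, m)) :
  U \in unitmx -> mx_equiv (block_mx U 0 X Y) (block_mx 1%:M 0 0 Y).
Proof.
move=> Uu; exists (block_mx 1%:M 0 (- X *m invmx U) 1%:M).
exists (block_mx (invmx U) 0 0 1%:M).
rewrite lblock_unitmx block_diag_mx_unit unitmx_inv Uu unitmx1; split=> //.
rewrite !mulmx_block !(mulmx1, mul1mx, mulmx0, mul0mx, addr0, add0r).
by rewrite mulmxV // mulmxKV // addNr mul0mx.
Qed.

(* Two fraction descriptions [Y N^-1 = E Psi^-1] of the same matrix, both right
   coprime, differ by a unimodular right factor. *)
Lemma coprime_fractions_unique p m (E Y : 'M[R]_(p, m)) (Psi N : 'M[R]_m)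
    K L K' L' :
  K *m Psi + L *m E = 1%:M -> K' *m N + L' *m Y = 1%:M -> \det Psi != 0 ->
  E^%:F *m invmx Psi^%:F *m N^%:F = Y^%:F ->
  exists2 T, T \in unitmx & Psi *m T = N /\ E *m T = Y.
Proof.
move=> KL KL' Psi_neq0 EY.
have [S NS YS] : exists2 S, N^%:F = Psi^%:F *m S & Y^%:F = E^%:F *m S.
  exists (invmx Psi^%:F *m N^%:F); last by rewrite mulmxA EY.
  by rewrite mulKVmx ?tofrac_unitmx.
(* Over the fraction field, [S = (K Psi + L E) S = K N + L Y], so [S] has entries in [R]. *)
pose T := K *m N + L *m Y.
have TS : T^%:F = S.
  rewrite map_mxD !map_mxM NS YS !mulmxA -mulmxDl.
  by rewrite -!map_mxM -map_mxD KL map_mx1 mul1mx.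
have PsiT : Psi *m T = N by apply: tofrac_mx_inj; rewrite map_mxM TS -NS.
have ET : E *m T = Y by apply: tofrac_mx_inj; rewrite map_mxM TS -YS.
exists T => //.
(* The second Bezout identity becomes a left inverse of [T]. *)
have : (K' *m Psi + L' *m E) *m T = 1%:M by rewrite mulmxDl -!mulmxA PsiT ET.
by case/mulmx1_unit.
Qed.

Variables n m p : nat.
Variables (A : 'M[R]_n) (B : 'M[R]_(n, m)).
Variables (C : 'M[R]_(p, n)) (D : 'M[R]_(p, m)).
Hypothesis A_neq0 : \det A != 0.

Lemma coprime_right_fraction : left_coprime A B -> right_coprime A C ->
  exists (N : 'M[R]_m) (Y : 'M[R]_(p, m)) K L,
  [/\ mx_equiv (block_mx A B C D) (block_mx 1%:M 0 0 Y),
      mx_equiv (block_mx A 0 0 1%:M) (block_mx 1%:M 0 0 N),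
      K *m N + L *m Y = 1%:M
    & transfer_function A B C D *m N^%:F = Y^%:F].
Proof.
move=> /(left_coprime_complete edd)[V Vu VE].
move=> /(right_coprime_bezout edd)[X [Z XZ]].
pose Q1 := dlsubmx V; pose Q2 := drsubmx V; pose W := invmx V.
pose W11 := ulsubmx W; pose W12 := ursubmx W.
pose W21 := dlsubmx W; pose N := drsubmx W.
have {}VE : V = block_mx A B Q1 Q2.
  rewrite -[LHS]submxK /ulsubmx /ursubmx VE row_mxKl row_mxKr //.
have WE : W = block_mx W11 W12 W21 N by rewrite submxK.
have := mulmxV Vu; rewrite -/W VE WE mulmx_block scalar_mx_block.
move=> /eq_block_mx[AB1 AB0 _ Q1N].
have AW : A *m W12 = - (B *m N) by apply/eqP; rewrite -addr_eq0 AB0.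
pose Y := C *m W12 + D *m N.
have CW : C *m W12 = Y - D *m N by rewrite addrK.
(* The coefficients come from [Q1 W12 + Q2 N = 1] after substituting [W12 = (X A + Z C) W12 = Z Y -
   (X B + Z D) N]. *)
exists N, Y, (Q2 - Q1 *m (X *m B + Z *m D)), (Q1 *m Z); split.
- apply: (@mx_equiv_trans _ _ _ _ (block_mx A B C D *m W)).
    by apply/mx_equiv_sym/mx_equivMr; rewrite unitmx_inv.
  by rewrite WE mulmx_block AB1 AB0; apply: mx_equiv_lblock; rewrite unitmx1.
(* The identity used is [V diag(I, N) [I W12; 0 I] = [A 0; Q1 I] = diag(A, I) [I 0; Q1 I]]. *)
- apply: mx_equiv_sym.
  apply: mx_equiv_trans (mx_equiv_sym (mx_equivMr _ (ublock_unitmx W12))) _.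
  apply: mx_equiv_trans (mx_equiv_sym (mx_equivMl _ Vu)) _.
  apply: mx_equiv_trans _ (mx_equivMr _ (lblock_unitmx Q1)).
  rewrite VE !mulmx_block !(mulmx1, mul1mx, mulmx0, mul0mx, addr0, add0r).
  by rewrite AB0 Q1N; exact: mx_equiv_refl.
- have W12E : W12 = Z *m Y - (X *m B + Z *m D) *m N.
    rewrite -[LHS]mul1mx -XZ !mulmxDl -!mulmxA AW CW mulmxN mulmxBr.
    by rewrite opprD addrCA.
  rewrite -Q1N W12E mulmxBl mulmxBr !mulmxA.
  by rewrite [LHS]addrC addrCA [LHS]addrC.
(* Since [B N = - A W12], the product [G N] is [D N + C W12 = Y]. *)
rewrite /transfer_function mulmxBl -(mulmxA _ B^%:F) -!map_mxM.
have -> : B *m N = - (A *m W12) by rewrite AW opprK.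
rewrite map_mxN (map_mxM _ A) mulmxN opprK -mulmxA mulKmx ?tofrac_unitmx //.
by rewrite -!map_mxM -map_mxD addrC.
Qed.

End Realization.

Lemma mulmx_invmx3 (K : comUnitRingType) n (L A Q : 'M[K]_n) :
  L \in unitmx -> A \in unitmx -> Q \in unitmx ->
  Q *m invmx (L *m A *m Q) *m L = invmx A.
Proof.
move=> Lu Au Qu.
have LAQu : L *m A *m Q \in unitmx by rewrite !unitmx_mul Lu Au.
apply: (can_inj (mulKmx Au)); apply: (can_inj (mulKmx Lu)).
by rewrite mulmxV // mulmx1 !mulmxA mulmxV // mul1mx.
Qed.

Lemma transfer_functionM (R : idomainType) n m p (L A Q : 'M[R]_n)
    (B : 'M[R]_(n, m)) (C : 'M[R]_(p, n)) (D : 'M[R]_(p, m)) :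
  \det L != 0 -> \det A != 0 -> \det Q != 0 ->
  transfer_function (L *m A *m Q) (L *m B) (C *m Q) D =
  transfer_function A B C D.
Proof.
move=> L_neq0 A_neq0 Q_neq0; rewrite /transfer_function.
rewrite (map_mxM _ C) (map_mxM _ L B) (map_mxM _ _ Q) (map_mxM _ L A).
have <- : Q^%:F *m invmx (L^%:F *m A^%:F *m Q^%:F) *m L^%:F = invmx A^%:F.
  by apply: mulmx_invmx3; rewrite tofrac_unitmx.
by rewrite !mulmxA.
Qed.

(** Finite choice, by induction on [k]; it collects the Bezout coefficients in
    [smith_mcmillan_bezout]. *)
Lemma seq_choice T (x0 : T) k (Q : nat -> T -> Prop) :
  (forall i, (i < k)%N -> exists x, Q i x) ->
  exists2 s, size s = k & forall i, (i < k)%N -> Q i (nth x0 s i).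
Proof.
elim: k => [|k IHk] Qk; first by exists [::].
have [i ik|s sk sQ] := IHk; first by apply: Qk; rewrite ltnW.
have [x Qx] := Qk k (ltnSn k); exists (rcons s x); rewrite ?size_rcons ?sk //.
move=> i; rewrite ltnS leq_eqVlt nth_rcons sk => /orP[/eqP->|ik].
  by rewrite ltnn eqxx.
by rewrite ik; apply: sQ.
Qed.

(** As [g] is 1-based, the final run of units starts at the 0-based index [g]. *)
Lemma last_nonunitP (R : idomainType) (s : seq R) (g := last_nonunit s) :
  [/\ (g <= size s)%N,
      forall i, (g <= i < size s)%N -> s`_i \is a GRing.unit
    & (0 < g)%N -> s`_g.-1 \isn't a GRing.unit].
Proof.
rewrite {}/g; split; first by apply/bigmax_leqP => i _.
  move=> i /andP[gi si]; apply: contraLR gi => nu; rewrite -ltnNge.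
  exact: (@leq_bigmax_cond _ (fun i : 'I_(size s) => s`_i \isn't a GRing.unit)
            (fun i => i.+1) (Ordinal si)).
rewrite /last_nonunit; elim/big_ind: _ => // x y Px Py.
by case: (leqP x y).
Qed.

(** * The coprime fraction given by the Smith-McMillan form, and the Smith forms of [P] and [A] *)

Section SmithMcMillan.
Variable R : idomainType.
Local Notation F := {fraction R}.
Hypothesis edd : elementary_divisor_domain R.
Variables n m p : nat.
Variables (eps psi : seq R) (G : 'M[F]_(p, m)).
Hypothesis smG : is_smith_mcmillan_form G eps psi.

(** The Smith-McMillan form is [E Psi^-1]; padding [psi] with ones makes [Psi] square and
    nonsingular. *)
Let E : 'M[R]_(p, m) := diag_pad p m eps.
Let psi1 := psi ++ nseq (m - size psi) 1.
Let Psi : 'M[R]_m := diag_pad m m psi1.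

Lemma smith_mcmillan_size :
  [/\ size eps = size psi, (size psi <= p)%N & (size psi <= m)%N].
Proof.
by have [[-> ->] _ _ _ _] := smG; rewrite rank_leq_row rank_leq_col.
Qed.

Lemma smith_mcmillan_det : \det Psi = \prod_(f <- psi) f.
Proof.
have [_ _ rm] := smith_mcmillan_size.
rewrite det_diag_pad; last by rewrite size_cat size_nseq subnKC.
by rewrite big_cat /= [X in _ * X]big1_seq ?mulr1 // => f /andP[_ /nseqP[]].
Qed.

(** The identity is solved entry by entry on the diagonal, where [eps_i] and [psi_i] are coprime. *)
Lemma smith_mcmillan_bezout : exists K L, K *m Psi + L *m E = 1%:M.
Proof.
have [_ _ _ cop _] := smG; have [er rp rm] := smith_mcmillan_size.
have [|k _ kl] := @seq_choice _ (0, 0) m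
    (fun i xy => xy.1 * psi1`_i + xy.2 * eps`_i = 1).
  move=> i im; have [ir|ri] := ltnP i (size psi).
    have ie : (i < size eps)%N by rewrite er.
    have [x [y xy]] := coprime_bezout edd (cop i ie).
    by exists (y, x); rewrite /= nth_cat ir addrC.
  (* Past the rank, the entry of [Psi] is a padding 1. *)
  exists (1, 0); rewrite /= nth_cat ltnNge ri /= nth_nseq ltn_sub2r //=.
    by rewrite mulr1 mul0r addr0.
  exact: leq_ltn_trans im.
pose k1 := map fst k; pose k2 := map snd k.
exists (diag_pad m m k1), (diag_pad m p k2).
have nth_k1 i : k1`_i = (nth (0, 0) k i).1.
  have [ik|ki] := ltnP i (size k); first by rewrite (nth_map (0, 0)).
  by rewrite !nth_default ?size_map.
have nth_k2 i : k2`_i = (nth (0, 0) k i).2.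
  have [ik|ki] := ltnP i (size k); first by rewrite (nth_map (0, 0)).
  by rewrite !nth_default ?size_map.
rewrite (@mul_diag_pad _ m m m _ _ (mkseq (fun i => k1`_i * psi1`_i) m));
  first last.
- by move=> i mi; rewrite nth_default ?size_mkseq.
- by move=> i im; rewrite nth_mkseq.
rewrite (@mul_diag_pad _ m p m _ _ (mkseq (fun i => k2`_i * eps`_i) p));
  first last.
- by move=> i mi; rewrite nth_default ?size_mkseq.
- by move=> i im; rewrite nth_mkseq.
apply/matrixP => i j; rewrite !mxE -val_eqE.
case: eqP => _; last by rewrite addr0.
rewrite nth_mkseq // -[RHS](kl i) // -nth_k1 -nth_k2; congr (_ + _).
(* Beyond row [p] of [E] there is no product entry, and [eps_i] is the default 0 since the rank is
   at most [p]. *)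
have [ip|pi] := ltnP i p; first by rewrite nth_mkseq.
rewrite [LHS]nth_default ?size_mkseq // [eps`_i]nth_default ?mulr0 //.
by rewrite er (leq_trans rp).
Qed.

Lemma smith_mcmillan_fraction : exists (U : 'M[R]_p) (V : 'M[R]_m),
  [/\ U \in unitmx, V \in unitmx & U^%:F *m G *m V^%:F *m Psi^%:F = E^%:F].
Proof.
have [_ [_ psi_neq0] _ _ [U [V [Uu Vu UGV]]]] := smG; exists U, V; split=> //.
have [er rp rm] := smith_mcmillan_size.
have nthF (s : seq R) i : (map (@tofrac R) s)`_i = (s`_i)%:F.
  have [si|si] := ltnP i (size s); first by rewrite (nth_map 0).
  by rewrite !nth_default ?size_map // tofrac0.
rewrite UGV !map_diag_pad.
apply: mul_diag_pad => i im; rewrite !nthF; last first.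
  by rewrite nth_default ?tofrac0 // er (leq_trans rm).
have [ir|ri] := ltnP i (size psi); last first.
  rewrite [eps`_i]nth_default ?er // [X in X * _]nth_default; last first.
    by rewrite size_map size_zip er minnn.
  by rewrite mul0r tofrac0.
rewrite (nth_map (0, 0)) ?size_zip ?er ?minnn // nth_zip //= nth_cat ir.
by rewrite divfK // tofrac_eq0 psi_neq0 // mem_nth.
Qed.

Variables (A : 'M[R]_n) (B : 'M[R]_(n, m)).
Variables (C : 'M[R]_(p, n)) (D : 'M[R]_(p, m)).
Hypothesis A_neq0 : \det A != 0.
Hypothesis GE : G = transfer_function A B C D.

Lemma coprime_realization : left_coprime A B -> right_coprime A C ->
  mx_equiv (block_mx A B C D) (block_mx 1%:M 0 0 E) /\
  mx_equiv (block_mx A 0 0 1%:M) (block_mx 1%:M 0 0 Psi).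
Proof.
move=> copAB copAC.
have [N [Y [K' [L' [PY AN KL' GN]]]]] :=
  coprime_right_fraction edd D A_neq0 copAB copAC.
have [K [L KL]] := smith_mcmillan_bezout.
have [U [V [Uu Vu EE]]] := smith_mcmillan_fraction.
have Psi_neq0 : \det Psi != 0.
  have [_ [_ psi_neq0] _ _ _] := smG.
  rewrite smith_mcmillan_det prodf_seq_neq0; apply/allP => f.
  exact: psi_neq0.
(* [G N = Y] becomes [(U G V) (V^-1 N) = U Y], which is compared with [U G V = E Psi^-1]. *)
have [||T Tu [NE YE]] := @coprime_fractions_unique _ _ _ E (U *m Y) Psi
    (invmx V *m N) K L (K' *m V) (L' *m invmx U) KL _ Psi_neq0.
- by rewrite !mulmxA mulmxK // mulmxKV.
- rewrite -EE mulmxK ?tofrac_unitmx // map_mxM mulmxA.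
  rewrite -[_ *m _ *m (invmx V)^%:F]mulmxA -map_mxM mulmxV // map_mx1 mulmx1.
  by rewrite -mulmxA GE GN -map_mxM.
have {}NE : N = V *m Psi *m T by rewrite -mulmxA NE mulKVmx.
have {}YE : Y = invmx U *m E *m T by rewrite -mulmxA YE mulKmx.
split.
  apply: mx_equiv_trans PY _; apply: mx_equiv_dsum; first exact: mx_equiv_refl.
  rewrite YE; apply: mx_equiv_trans (mx_equivMr _ Tu) _.
  by apply: mx_equivMl; rewrite unitmx_inv.
apply: mx_equiv_trans AN _; apply: mx_equiv_dsum; first exact: mx_equiv_refl.
rewrite NE; apply: mx_equiv_trans (mx_equivMr _ Tu) _.
exact: mx_equivMl.
Qed.

Lemma coprime_realization_det : left_coprime A B -> right_coprime A C ->
  exists2 u, u \is a GRing.unit & \prod_(f <- psi) f = u * \det A.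
Proof.
move=> copAB copAC.
have [_ /mx_equiv_det[u uu]] := coprime_realization copAB copAC.
rewrite !det_ublock !det1 mulr1 mul1r.
by rewrite smith_mcmillan_det => psiA; exists u.
Qed.

Let g := last_nonunit psi.

Lemma coprime_realization_smith_P : left_coprime A B -> right_coprime A C ->
  is_smith_form (block_mx A B C D) (nseq n 1 ++ eps).
Proof.
move=> copAB copAC; have [PE _] := coprime_realization copAB copAC.
have [_ [eps_neq0 _] [che _] _ _] := smG.
have [er rp rm] := smith_mcmillan_size.
apply: mx_equiv_smith_form.
- move=> a; rewrite mem_cat => /orP[/nseqP[-> _]|]; first exact: oner_neq0.
  exact: eps_neq0.
- by rewrite size_cat size_nseq leq_add2l er.
- by rewrite size_cat size_nseq leq_add2l er.
- by apply/div_chain_ones/div_chain_sub.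
by rewrite diag_pad_cat ?size_nseq // diag_pad1.
Qed.

(** Uniqueness is applied in size [n + m], to the chains [1^m, a] for [diag(A, I)] and
    [1^(n+m-r), psi_r, ..., psi_1] for [diag(I, Psi)], where [a] is a Smith form of [A]. Dropping
    the first [m] entries recovers [a]. *)
Lemma coprime_realization_smith_A : left_coprime A B -> right_coprime A C ->
  is_smith_form A (nseq (n - g) 1 ++ rev (take g psi)).
Proof.
move=> copAB copAC; have [_ APsi] := coprime_realization copAB copAC.
have [_ [_ psi_neq0] [_ chp] _ _] := smG; have [_ _ rm] := smith_mcmillan_size.
have [a [sa cha Aa]] := smith_exists edd A; rewrite minnn in sa.
have [gr unit_psi nonunit_psi] := last_nonunitP psi.
rewrite -/g in gr unit_psi nonunit_psi.
have chr : div_chain (rev psi) by exact: div_chain_rev.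
have apsi : mx_equiv (diag_pad (n + m) (n + m) (nseq m 1 ++ a))
    (diag_pad (n + m) (n + m) (nseq (n + (m - size psi)) 1 ++ rev psi)).
  have aA : mx_equiv (diag_pad (n + m) (n + m) (nseq m 1 ++ a))
      (block_mx A 0 0 1%:M).
    apply: (@mx_equiv_trans _ _ _ _ (diag_pad (n + m) (n + m) (a ++ nseq m 1))).
      apply: diag_pad_perm; first by rewrite size_cat size_nseq sa addnC.
      by rewrite perm_catC.
    rewrite diag_pad_cat // diag_pad1; apply: mx_equiv_dsum (mx_equiv_refl _).
    exact: mx_equiv_sym.
  apply: mx_equiv_trans aA (mx_equiv_trans APsi _).
  rewrite -diag_pad1 -diag_pad_cat ?size_nseq //.
  apply: diag_pad_perm; rewrite ?size_cat ?size_nseq ?subnKC //.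
  rewrite nseqD -catA perm_cat2l /psi1 perm_catC perm_cat2l perm_sym.
  by rewrite perm_rev.
have uniq k : (k < n + m)%N -> exists2 u, u \is a GRing.unit &
    (nseq (n + (m - size psi)) 1 ++ rev psi)`_k = u * (nseq m 1 ++ a)`_k.
  by move=> km; apply: (smith_unique _ _ km km apsi); exact: div_chain_ones.
have nth_psi k : (k < size psi)%N -> (rev psi)`_k = psi`_(size psi - k.+1).
  exact: nth_rev.
(* If [g > n], the nonunit [psi_g] would sit at index [n + m - g < m], where the chain of
   [diag(A, I)] has a 1. *)
have gn : (g <= n)%N.
  rewrite leqNgt; apply/negP => ng; have g0 : (0 < g)%N by apply: leq_trans ng.
  have [|u uu] := uniq (n + m - g)%N; first by lia.
  rewrite !nth_cat !size_nseq.
  have -> : (n + m - g < n + (m - size psi) = false)%N by lia.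
  have nm : (n + m - g < m)%N by lia.
  rewrite nm nth_nseq nm mulr1 nth_psi; last by lia.
  have -> : (size psi - (n + m - g - (n + (m - size psi))).+1 = g.-1)%N by lia.
  by move=> psi_u; move: (nonunit_psi g0); rewrite psi_u uu.
have nth_t i : (i < n)%N -> exists2 u, u \is a GRing.unit &
    (nseq (n - g) 1 ++ rev (take g psi))`_i = u * a`_i.
  move=> ni; have [|u uu] := uniq (m + i)%N; first by lia.
  rewrite [in X in _ = u * X -> _]nth_cat size_nseq ltnNge leq_addr addKn => tE.
  have [v vu vE] : exists2 v, v \is a GRing.unit &
      (nseq (n - g) 1 ++ rev (take g psi))`_i =
      v * (nseq (n + (m - size psi)) 1 ++ rev psi)`_(m + i).
    rewrite !nth_cat !size_nseq.
    (* For [i < n - g], the large chain has at index [m + i] either a padding 1 or [psi] at the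
       0-based index [n - 1 - i >= g], a unit. *)
    have [ig|gi] := ltnP i (n - g).
      rewrite nth_nseq ig; case: ltnP => mi.
        by rewrite nth_nseq mi; exists 1; rewrite ?unitr1 ?mulr1.
      rewrite nth_psi; last by lia.
      set k := (_ - _.+1)%N; have ku : psi`_k \is a GRing.unit.
        by apply: unit_psi; lia.
      by exists (psi`_k)^-1; rewrite ?unitrV // mulVr.
    rewrite ifF; last by lia.
    exists 1; rewrite ?unitr1 // mul1r nth_psi; last by lia.
    rewrite nth_rev size_takel // ?nth_take; try lia.
    by congr (_`_ _); lia.
  by exists (v * u); rewrite ?unitrM ?vu // vE tE mulrA.
apply: mx_equiv_smith_form.
- move=> b; rewrite mem_cat mem_rev => /orP[/nseqP[-> _]|/mem_take].
    exact: oner_neq0.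
  exact: psi_neq0.
- by rewrite size_cat size_nseq size_rev size_takel ?subnK.
- by rewrite size_cat size_nseq size_rev size_takel ?subnK.
- apply/div_chain_ones/div_chain_rev => i; rewrite size_takel // => ig.
  by rewrite !nth_take ?(ltnW ig) //; apply: chp; apply: leq_trans ig gr.
apply: mx_equiv_trans Aa _; exact: diag_pad_assoc.
Qed.

End SmithMcMillan.

(** * Coprimeness of the realization in terms of the Smith forms of [P] and [A] *)

Theorem theorem4p11 (R : idomainType)
    (hEDD : elementary_divisor_domain R)
    (hnotfield : ~ GRing.field_axiom R)
    (n m p : nat)
    (A : 'M[R]_n) (B : 'M[R]_(n, m)) (C : 'M[R]_(p, n)) (D : 'M[R]_(p, m))
    (hA : \det A != 0)
    (P : 'M[R]_(n + p, n + m)) (hP : P = block_mx A B C D)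
    (G : 'M[{fraction R}]_(p, m)) (hG : G = transfer_function A B C D)
    (eps psi : seq R) (hSG : is_smith_mcmillan_form G eps psi)
    (g : nat) (hg : g = last_nonunit psi) :
  (left_coprime A B /\ right_coprime A C) <->
  (is_smith_form P (nseq n 1 ++ eps) /\
   is_smith_form A (nseq (n - g) 1 ++ rev (take g psi))).
Proof.
rewrite {}hP; split=> [[copAB copAC]|[_ smA]].
  rewrite hg; split; first exact: (coprime_realization_smith_P hEDD hSG).
  exact: (coprime_realization_smith_A hEDD hSG hA hG).
have [L [A1 [B1 [AE BE copAB1]]]] := left_coprime_factor hEDD A B.
have [Q [A2 [C1 [A1E CE copAC2]]]] := right_coprime_factor hEDD A1 C.
have [X [Y XY]] := left_coprime_bezout hEDD copAB1.
have [X' [Z XZ]] := right_coprime_bezout hEDD copAC2.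
(* Extracting [Q] keeps left coprimeness: [A1 X + B1 Y = A2 (Q X) + B1 Y]. *)
have copAB2 : left_coprime A2 B1.
  by apply: (@bezout_left_coprime _ _ _ _ _ _ (Q *m X) Y); rewrite mulmxA -A1E.
have AE2 : A = L *m A2 *m Q by rewrite AE A1E mulmxA.
have detA : \det A = \det L * \det A2 * \det Q by rewrite AE2 !det_mulmx.
have /andP[/andP[L_neq0 A2_neq0] Q_neq0] :
    (\det L != 0) && (\det A2 != 0) && (\det Q != 0).
  by move: hA; rewrite detA !mulf_eq0 !negb_or.
have G2 : G = transfer_function A2 B1 C1 D.
  by rewrite hG AE2 BE CE transfer_functionM.
have [u uu psiA2] := coprime_realization_det hEDD hSG A2_neq0 G2 copAB2 copAC2.
case: smA => s_size _ _ /equivalent_tofrac/mx_equiv_det[v vu].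
rewrite mxrank_unit ?tofrac_unitmx // in s_size.
rewrite det_diag_pad // big_cat /= big_rev [X in X * _]big1_seq ?mul1r;
  last first.
  by move=> a /andP[_ /nseqP[]].
move=> take_psi.
have [_ unit_psi _] := last_nonunitP psi; rewrite -hg in unit_psi.
(* Past [g] all [psi_i] are units, so the first [g] of them carry the whole product up to a unit. *)
have drop_unit : \prod_(f <- drop g psi) f \is a GRing.unit.
  rewrite big_seq; apply: rpred_prod => f /(nthP 0)[i].
  rewrite size_drop => ig <-.
  by rewrite nth_drop unit_psi // leq_addr /= -ltn_subRL.
have /andP[Lu Qu] : (\det L \is a GRing.unit) && (\det Q \is a GRing.unit).
  rewrite -unitrM; move: uu.
  (* Both expressions for the product of the [psi_i] are compared and [det A2] is cancelled;
     [det L * det Q] then divides the unit [u]. *)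
  have -> : u = v * (\prod_(f <- drop g psi) f) * (\det L * \det Q).
    apply: (mulIf A2_neq0); rewrite -psiA2 -(cat_take_drop g psi) big_cat /=.
    by rewrite cat_take_drop take_psi detA; ring.
  by rewrite (unitrM (v * _)) => /andP[].
have [LU QU] : L \in unitmx /\ Q \in unitmx by rewrite !unitmxE.
split.
  (* Conjugating [A1 X + B1 Y = 1] by [L]. *)
  apply: (@bezout_left_coprime _ _ _ _ _ _ (X *m invmx L) (Y *m invmx L)).
  by rewrite AE BE !mulmxA -mulmxDl -!mulmxA -mulmxDr XY mulmx1 mulmxV.
(* Conjugating [X' A2 + Z C1 = 1] by [Q], with [L] cancelled inside [A]. *)
apply: (@bezout_right_coprime _ _ _ _ _ _
  (invmx Q *m X' *m invmx L) (invmx Q *m Z)).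
rewrite AE2 CE !mulmxA mulmxKV // -mulmxDl -!(mulmxA (invmx Q)) -mulmxDr XZ.
by rewrite mulmx1 mulVmx.
Qed.
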